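(* Let $G$ be a discrete quantum group and let $l$ be a length function on $G$. (a) If $G$ has polynomial growth with respect to $l$, then $G$ has property RD with respect to $l$. (b) If $G$ is amenable and has property RD with respect to $l$, then $G$ has polynomial growth with respect to $l$. In particular, rapid decay and polynomial growth are equivalent in the amenable case.
   Context: Discrete quantum groups. A discrete quantum group $G$ is given by its reduced group $C^*$-algebra $C^*_{\mathsf r}(G)$ (the reduced unital Hopf $C^*$-algebra of the dual compact quantum group), with Haar state $\hat\phi$. $\mathrm{Irr}(G)$ is the set of equivalence classes of irreducible finite dimensional unitary corepresentations of $G$ (unitaries $X\in C^*_{\mathsf r}(G)\otimes\mathbb{L}(\mathcal{H})$ with $(\hat\Delta\otimes\mathrm{id})(X)=X_{13}X_{23}$); $\epsilon$ is the trivial one and $\bar\alpha$ the conjugate of $\alpha$. $\mathbb{C}[G]\subset C^*_{\mathsf r}(G)$ is the dense Hopf $*$-algebra of matrix coefficients, with antipode $S$. $C^*_{\mathsf r}(G)$ acts on the GNS space $l^2(G)$ of $\hat\phi$, with operator norm $\|\cdot\|_{op}$. $G$ is amenable if the canonical quotient map $C^*_{\mathsf f}(G)\to C^*_{\mathsf r}(G)$ from the full group $C^*$-algebra is an isomorphism. $C_c(G)=\bigoplus_{\alpha}\mathbb{L}(\mathcal{H}_\alpha)$ (algebraic direct sum over $\mathrm{Irr}(G)$), $C(G)=\prod_\alpha\mathbb{L}(\mathcal{H}_\alpha)$, and $p_\alpha$ is the unit of the block $\alpha$; $C_c(G)$ and $\mathbb{C}[G]$ are in canonical duality and elements of one are viewed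 as functionals on the other. The modular function is $F=(F^\alpha)_\alpha\in C(G)$, with each $F^\alpha$ positive invertible and $\mathrm{tr}(F^\alpha)=\mathrm{tr}((F^\alpha)^{-1})=\dim_q(\alpha)$. The left Haar functional is $\phi(f)=\sum_\alpha\dim_q(\alpha)\mathrm{tr}(Fp_\alpha f)$. The Fourier transform $\mathcal{F}:C_c(G)\to\mathbb{C}[G]$ is $\mathcal{F}(f)(h)=\phi(hf)$. Length functions. A length function is $l:\mathrm{Irr}(G)\to[0,\infty)$ with $l(\epsilon)=0$, $l(\bar\alpha)=l(\alpha)$, and $l(\alpha)\le l(\beta)+l(\gamma)$ whenever $\alpha\subset\beta\otimes\gamma$. It corresponds to the central length $L=\sum_\alpha l(\alpha)p_\alpha\in C(G)$. Property RD. For $s\ge0$ and $f\in C_c(G)$ let $$\|f\|_{2,s}^2=\sum_{\alpha\in\mathrm{Irr}(G)}\frac{\dim_q(\alpha)^2}{\dim(\alpha)}\mathrm{tr}\big(p_\alpha((1+L)^sfF)^*(1+L)^sfF\big).$$ $G$ has property RD with respect to $l$ (equivalently $L$) if there are constants $c,s>0$ such that $\|\mathcal{F}(f)\|_{op}\le c\|f\|_{2,s}$ for all $f\in C_c(G)$; $G$ has property RD (rapid decay) if this holds for some length function. Polynomial growth. $G$ has polynomial growth with respect to $l$ if there is a polynomial $p\in\mathbb{R}[x]$ such that $\sum_{l(\alpha)\in(n-1,n]}\dim(\alpha)^2\le p(n)$ for all $n\in\mathbb{N}=\{0,1,2,\dots\}$; $G$ has polynomial growth if this holds for some length function. *)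

(* Defs.v *)
From HB Require Import structures.
From mathcomp Require Import all_boot all_order all_algebra complex.
From mathcomp Require Import all_classical all_reals all_analysis.
Set Implicit Arguments.
Unset Strict Implicit.
Unset Printing Implicit Defensive.
Import Order.TTheory GRing.Theory Num.Theory.
Local Open Scope classical_set_scope.
Local Open Scope ring_scope.
Local Open Scope sesquilinear_scope.

(** ** Unital C*-algebras

The norm is real-valued and is kept apart from the [normedModType] hierarchy:
Hierarchy Builder accepts no structure joining [GRing.Algebra] and
[CompleteNormedModule] (it would have to lie below [Num.NumDomain]), while the
ring structure of [algType] is what makes matrices over a C*-algebra usable. *)

Record cstarAlg (R : realType) := CStarAlg {
  calg :> algType R[i];
  star : calg -> calg;
  cnorm : calg -> R;
  starD : forall x y, star (x + y) = star x + star y;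
  starZ : forall (c : R[i]) x, star (c *: x) = c^* *: star x;
  starM : forall x y, star (x * y) = star y * star x;
  starK : forall x, star (star x) = x;
  cnorm_eq0 : forall x, cnorm x = 0 -> x = 0;
  cnormD : forall x y, cnorm (x + y) <= cnorm x + cnorm y;
  cnormZ : forall (c : R[i]) x, cnorm (c *: x) = complex.Re `|c| * cnorm x;
  cnormM : forall x y, cnorm (x * y) <= cnorm x * cnorm y;
  cnorm_star : forall x, cnorm (star x * x) = cnorm x ^+ 2;
  cnorm_complete : forall u : nat -> calg,
    (forall e : R, 0 < e -> exists N, forall m n,
       (N <= m)%N -> (N <= n)%N -> cnorm (u m - u n) < e) ->
    exists x, forall e : R, 0 < e -> exists N, forall n,
       (N <= n)%N -> cnorm (u n - x) < e }.

Definition lin_span (R : realType) (V : lmodType R[i]) (E : set V) : set V :=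
  [set x | exists (n : nat) (c : 'I_n -> R[i]) (e : 'I_n -> V),
     (forall k, E (e k)) /\ x = \sum_(k < n) c k *: e k].

Definition norm_dense (R : realType) (A : cstarAlg R) (D : set A) : Prop :=
  forall (x : A) (e : R), 0 < e -> exists2 y, D y & cnorm (x - y) < e.

(* Unital *-homomorphism defined on a unital *-subalgebra [D] of [A]; the values
   of [f] outside [D] are irrelevant. *)
Record star_hom_on (R : realType) (A B : cstarAlg R) (D : set A) (f : A -> B)
    : Prop := StarHomOn {
  star_hom1 : f 1 = 1;
  star_homD : forall x y, D x -> D y -> f (x + y) = f x + f y;
  star_homZ : forall (c : R[i]) x, D x -> f (c *: x) = c *: f x;
  star_homM : forall x y, D x -> D y -> f (x * y) = f x * f y;
  star_homS : forall x, D x -> f (star x) = star (f x) }.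

Definition star_hom (R : realType) (A B : cstarAlg R) (f : A -> B) : Prop :=
  star_hom_on setT f.

(** ** Minimal tensor product *)

(* [T] contains the algebraic tensor product of [A] and [B], the elementary
   tensor of [a] and [b] being [i a * j b]; equivalently, the norm of [T] induces
   a C*-norm on the algebraic tensor product. *)
Record alg_tensor_in (R : realType) (A B T : cstarAlg R)
    (i : A -> T) (j : B -> T) : Prop := AlgTensorIn {
  tens_homl : star_hom i;
  tens_homr : star_hom j;
  tens_comm : forall a b, i a * j b = j b * i a;
  tens_inj : forall (n : nat) (a : 'I_n -> A) (b : 'I_n -> B),
    (forall c : 'I_n -> R[i], \sum_(k < n) c k *: b k = 0 -> forall k, c k = 0) ->
    \sum_(k < n) i (a k) * j (b k) = 0 -> forall k, a k = 0 }.

(* The completion of the algebraic tensor product for its least C*-norm. *)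
Record min_tensor (R : realType) (A B T : cstarAlg R)
    (i : A -> T) (j : B -> T) : Prop := MinTensor {
  min_tensor_alg : alg_tensor_in i j;
  min_tensor_dense :
    norm_dense (lin_span [set x | exists a b, x = i a * j b]);
  min_tensor_least : forall (T' : cstarAlg R) (i' : A -> T') (j' : B -> T'),
    alg_tensor_in i' j' ->
    forall (n : nat) (a : 'I_n -> A) (b : 'I_n -> B),
      cnorm (\sum_(k < n) i (a k) * j (b k)) <=
      cnorm (\sum_(k < n) i' (a k) * j' (b k)) }.

(** ** Unital Hopf C*-algebras *)

(* [(Delta (x) id) Delta = (id (x) Delta) Delta]. [A3] is the minimal tensor product
   of [A2] and [A], with embeddings [k12] and [k3]; [k23] places [A2] on the legs
   2 and 3; [Dl] and [Dr] are [Delta (x) id] and [id (x) Delta]. *)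
Definition coassociative (R : realType) (A A2 : cstarAlg R)
    (i1 i2 : A -> A2) (Delta : A -> A2) : Prop :=
  exists (A3 : cstarAlg R) (k12 : A2 -> A3) (k3 : A -> A3)
         (k23 Dl Dr : A2 -> A3),
    [/\ min_tensor k12 k3,
        star_hom k23 /\
          (forall a, k23 (i1 a) = k12 (i2 a) /\ k23 (i2 a) = k3 a),
        star_hom Dl /\
          (forall a, Dl (i1 a) = k12 (Delta a) /\ Dl (i2 a) = k3 a),
        star_hom Dr /\
          (forall a, Dr (i1 a) = k12 (i1 a) /\ Dr (i2 a) = k23 (Delta a))
      & forall a, Dl (Delta a) = Dr (Delta a)].

Record hopfCstar (R : realType) := HopfCstar {
  cr :> cstarAlg R;
  cr2 : cstarAlg R;
  leg1 : cr -> cr2;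
  leg2 : cr -> cr2;
  legs_min : min_tensor leg1 leg2;
  Delta : cr -> cr2;
  Delta_hom : star_hom Delta;
  Delta_coassoc : coassociative leg1 leg2 Delta;
  cancel_left :
    norm_dense (lin_span [set x | exists a b, x = leg1 a * Delta b]);
  cancel_right :
    norm_dense (lin_span [set x | exists a b, x = leg2 a * Delta b]) }.

(** ** Finite dimensional unitary corepresentations

[X] in [A (x) L(C^n)] is written as the matrix of its coefficients [X i j] in [A];
[map_mx in_alg M] is the scalar matrix [1 (x) M]. *)

Definition adjA (R : realType) (A : cstarAlg R) (m n : nat)
    (X : 'M[A]_(m, n)) : 'M[A]_(n, m) := map_mx (@star R A) X^T.

Definition scA (R : realType) (A : cstarAlg R) (m n : nat)
    (M : 'M[R[i]]_(m, n)) : 'M[A]_(m, n) := map_mx (in_alg A) M.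

Record ucorep (R : realType) (G : hopfCstar R) := UCorep {
  cdim : nat;
  cmx : 'M[cr G]_cdim;
  cmx_unitaryl : adjA cmx *m cmx = 1%:M;
  cmx_unitaryr : cmx *m adjA cmx = 1%:M;
  cmx_corep : forall i j, Delta (cmx i j) =
    \sum_(k < cdim) leg1 (cmx i k) * leg2 (cmx k j) }.

(* No subspace of [C^n] other than 0 and [C^n] is invariant; a subspace is given by
   its orthogonal projection. *)
Definition irreducible (R : realType) (G : hopfCstar R) (X : ucorep G) : Prop :=
  (0 < cdim X)%N /\
  forall p : 'M[R[i]]_(cdim X), p^t* = p -> p *m p = p ->
    cmx X *m scA G p = scA G p *m cmx X *m scA G p -> p = 0 \/ p = 1%:M.

Definition similar (R : realType) (A : cstarAlg R) (m n : nat)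
    (X : 'M[A]_m) (Y : 'M[A]_n) : Prop :=
  exists (T : 'M[R[i]]_(n, m)) (T' : 'M[R[i]]_(m, n)),
    [/\ T *m T' = 1%:M, T' *m T = 1%:M & scA A T *m X = Y *m scA A T].

Definition equivalent (R : realType) (G : hopfCstar R) (X Y : ucorep G) : Prop :=
  similar (cmx X) (cmx Y).

Definition is_trivial (R : realType) (G : hopfCstar R) (X : ucorep G) : Prop :=
  cdim X = 1%N /\ cmx X = 1%:M.

(* The entrywise adjoint of [cmx X] need not be unitary, so the conjugate is
   determined by similarity through an arbitrary invertible matrix. *)
Definition is_conjugate (R : realType) (G : hopfCstar R) (X Y : ucorep G)
    : Prop := similar (cmx Y) (map_mx (@star R G) (cmx X)).

(* [X] is contained in the tensor product of [Y] and [Z], which is [Y_12 Z_13], with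
   coefficients [Y i j * Z k l]: there is an isometric intertwiner [T]. *)
Definition sub_tensor (R : realType) (G : hopfCstar R) (X Y Z : ucorep G)
    : Prop :=
  exists T : 'M[R[i]]_(cdim Y * cdim Z, cdim X),
    T^t* *m T = 1%:M /\
    forall i k a,
      \sum_b T (mxvec_index i k) b *: cmx X b a =
      \sum_j \sum_l T (mxvec_index j l) a *: (cmx Y i j * cmx Z k l).

(* The space C[G] of matrix coefficients. *)
Definition coeffs (R : realType) (G : hopfCstar R) : set G :=
  lin_span [set a | exists (X : ucorep G) i j, a = cmx X i j].
Arguments coeffs {R} G.

(** ** Discrete quantum groups *)

(* [E] is the slice map [id (x) w] when [i, j] are the first and second legs, and
   [w (x) id] when they are exchanged. *)
Definition is_slice (R : realType) (A A2 : cstarAlg R) (i j : A -> A2)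
    (w : {scalar A}) (E : {linear A2 -> A}) : Prop :=
  (forall a b, E (i a * j b) = w b *: a) /\
  exists M : R, forall x, cnorm (E x) <= M * cnorm x.

(* The norm of [a] acting by left multiplication on the GNS space of [h], i.e. on
   the completion of [A] for the inner product [h (star b * b')]. *)
Definition gns_norm (R : realType) (A : cstarAlg R) (h : {scalar A}) (a : A) : R :=
  sup [set Num.sqrt (complex.Re (h (star (a * b) * (a * b)))) |
       b in [set b : A | complex.Re (h (star b * b)) <= 1]].

(* The counit and antipode of the dense Hopf *-algebra [coeffs G] exist and are
   unique for every Hopf C*-algebra as above (Woronowicz), as is the Haar state;
   they are recorded as data. Only the values of [counit] and [antipode] on
   [coeffs G] matter. [reduced] says that C*_r(G) is a C*-algebra of operators on
   the GNS space l^2(G) of its Haar state. *)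
Record dqg (R : realType) := DQG {
  dqg_hopf :> hopfCstar R;
  haar : {scalar dqg_hopf};
  haar1 : haar 1 = 1;
  haar_ge0 : forall a, 0 <= haar (star a * a);
  haar_right : exists E, is_slice (@leg1 R dqg_hopf) (@leg2 R dqg_hopf) haar E /\
    forall a, E (Delta a) = (haar a)%:A;
  haar_left : exists E, is_slice (@leg2 R dqg_hopf) (@leg1 R dqg_hopf) haar E /\
    forall a, E (Delta a) = (haar a)%:A;
  reduced : forall a : dqg_hopf, cnorm a = gns_norm haar a;
  coeffs_dense : norm_dense (coeffs dqg_hopf);
  coeffs1 : coeffs dqg_hopf 1;
  coeffsM : forall a b, coeffs dqg_hopf a -> coeffs dqg_hopf b ->
    coeffs dqg_hopf (a * b);
  coeffs_star : forall a, coeffs dqg_hopf a -> coeffs dqg_hopf (star a);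
  counit : dqg_hopf -> R[i];
  counit1 : counit 1 = 1;
  counitD : forall a b, coeffs dqg_hopf a -> coeffs dqg_hopf b ->
    counit (a + b) = counit a + counit b;
  counitZ : forall (c : R[i]) a, coeffs dqg_hopf a ->
    counit (c *: a) = c * counit a;
  counitM : forall a b, coeffs dqg_hopf a -> coeffs dqg_hopf b ->
    counit (a * b) = counit a * counit b;
  counit_star : forall a, coeffs dqg_hopf a -> counit (star a) = (counit a)^*;
  antipode : dqg_hopf -> dqg_hopf;
  antipode_coeffs : forall a, coeffs dqg_hopf a ->
    coeffs dqg_hopf (antipode a);
  antipodeD : forall a b, coeffs dqg_hopf a -> coeffs dqg_hopf b ->
    antipode (a + b) = antipode a + antipode b;
  antipodeZ : forall (c : R[i]) a, coeffs dqg_hopf a ->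
    antipode (c *: a) = c *: antipode a;
  hopf_axioms : forall a (n : nat) (b c : 'I_n -> dqg_hopf),
    coeffs dqg_hopf a ->
    (forall k, coeffs dqg_hopf (b k)) -> (forall k, coeffs dqg_hopf (c k)) ->
    Delta a = \sum_(k < n) leg1 (b k) * leg2 (c k) ->
    [/\ \sum_(k < n) counit (b k) *: c k = a,
        \sum_(k < n) counit (c k) *: b k = a,
        \sum_(k < n) antipode (b k) * c k = (counit a)%:A
      & \sum_(k < n) b k * antipode (c k) = (counit a)%:A] }.

(* The operator norm on l^2(G). *)
Definition op_norm (R : realType) (G : dqg R) : G -> R := gns_norm (@haar R G).

(** ** Amenability *)

(* [B] with [iota : C[G] -> B] is the full C*-algebra C*_f(G), i.e. the enveloping
   C*-algebra of C[G]. *)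
Definition is_full_cstar (R : realType) (G : dqg R) (B : cstarAlg R)
    (iota : G -> B) : Prop :=
  star_hom_on (coeffs G) iota /\
  forall (D : cstarAlg R) (rho : G -> D), star_hom_on (coeffs G) rho ->
    exists! sigma : B -> D,
      star_hom sigma /\ forall a, coeffs G a -> sigma (iota a) = rho a.

Definition amenable (R : realType) (G : dqg R) : Prop :=
  exists (B : cstarAlg R) (iota : G -> B) (q : B -> G),
    [/\ is_full_cstar iota, star_hom q,
        forall a, coeffs G a -> q (iota a) = a & bijective q].

(** ** Irr(G), C_c(G) and the Fourier transform *)

(* A choice of one representative [rep alpha] for each class [alpha] in Irr(G),
   with the modular matrices and the duality between C(G) and C[G]. The matrix
   [modF alpha] is the positive F^alpha such that
   [(S^2 (x) id)(X) = (1 (x) F) X (1 (x) F^-1)] and [tr F = tr F^-1]; it exists and is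
   unique, and it is the one for which the functional [phi] below is
   left-invariant, C(G) being dual to C[G] by [f (X_alpha i j) = f_alpha i j]. *)
Record irr_data (R : realType) (G : dqg R) := IrrData {
  Irr : choiceType;
  rep : Irr -> ucorep G;
  rep_irr : forall alpha, irreducible (rep alpha);
  rep_inj : forall alpha beta, equivalent (rep alpha) (rep beta) -> alpha = beta;
  rep_surj : forall X, irreducible X -> exists alpha, equivalent X (rep alpha);
  modF : forall alpha, 'M[R[i]]_(cdim (rep alpha));
  modF_herm : forall alpha, (modF alpha)^t* = modF alpha;
  modF_gt0 : forall alpha (v : 'cV[R[i]]_(cdim (rep alpha))), v != 0 ->
    0 < (v^t* *m modF alpha *m v) 0 0;
  modF_S2 : forall alpha,
    map_mx (fun a => antipode (antipode a)) (cmx (rep alpha)) =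
    scA G (modF alpha) *m cmx (rep alpha) *m scA G (invmx (modF alpha));
  modF_tr : forall alpha, \tr (modF alpha) = \tr (invmx (modF alpha));
  pairing : (forall alpha, 'M[R[i]]_(cdim (rep alpha))) -> G -> R[i];
  pairing_lin : forall f (c : R[i]) a b, coeffs G a -> coeffs G b ->
    pairing f (c *: a + b) = c * pairing f a + pairing f b;
  pairing_coeff : forall f alpha i j,
    pairing f (cmx (rep alpha) i j) = f alpha i j }.

Definition dimI (R : realType) (G : dqg R) (D : irr_data G) (alpha : Irr D)
    : nat := cdim (rep alpha).

Definition dimq (R : realType) (G : dqg R) (D : irr_data G) (alpha : Irr D)
    : R[i] := \tr (modF alpha).

(* The elements of C(G); those of C_c(G) have finite support. *)
Definition CG (R : realType) (G : dqg R) (D : irr_data G) : Type :=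
  forall alpha : Irr D, 'M[R[i]]_(cdim (rep alpha)).

Definition in_Cc (R : realType) (G : dqg R) (D : irr_data G) (f : CG D) : Prop :=
  finite_set [set alpha | f alpha != 0].

Definition mulCG (R : realType) (G : dqg R) (D : irr_data G) (f g : CG D)
    : CG D := fun alpha => f alpha *m g alpha.

(* The left Haar functional, on C_c(G) (where the sum is finite). *)
Definition phi (R : realType) (G : dqg R) (D : irr_data G) (f : CG D) : R[i] :=
  \sum_(alpha \in [set: Irr D]) dimq alpha * \tr (modF alpha *m f alpha).

(* The unique element [a] of C[G] such that [h(a) = phi(h f)] for all [h] in
   C_c(G). *)
Definition fourier (R : realType) (G : dqg R) (D : irr_data G) (f : CG D) : G :=
  xget 0 [set a | coeffs G a /\
    forall h : CG D, in_Cc h -> pairing h a = phi (mulCG h f)].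

(** ** Length functions, property RD and polynomial growth *)

Record length_function (R : realType) (G : dqg R) (D : irr_data G)
    (l : Irr D -> R) : Prop := LengthFunction {
  length_ge0 : forall alpha, 0 <= l alpha;
  length_triv : forall alpha, is_trivial (rep alpha) -> l alpha = 0;
  length_conj : forall alpha beta,
    is_conjugate (rep alpha) (rep beta) -> l beta = l alpha;
  length_tens : forall alpha beta gamma,
    sub_tensor (rep alpha) (rep beta) (rep gamma) ->
    l alpha <= l beta + l gamma }.

Definition norm2 (R : realType) (G : dqg R) (D : irr_data G) (l : Irr D -> R)
    (s : R) (f : CG D) : R :=
  let g (alpha : Irr D) :=
    ((1 + l alpha) `^ s)%:C%C *: (f alpha *m modF alpha) in
  Num.sqrt (complex.Re (\sum_(alpha \in [set: Irr D])
    dimq alpha ^+ 2 / (dimI alpha)%:R * \tr ((g alpha)^t* *m g alpha))).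

Definition rapid_decay_wrt (R : realType) (G : dqg R) (D : irr_data G)
    (l : Irr D -> R) : Prop :=
  exists c s : R, [/\ 0 < c, 0 < s
    & forall f : CG D, in_Cc f -> op_norm (fourier f) <= c * norm2 l s f].

Definition rapid_decay (R : realType) (G : dqg R) (D : irr_data G) : Prop :=
  exists2 l : Irr D -> R, length_function l & rapid_decay_wrt l.

Definition poly_growth_wrt (R : realType) (G : dqg R) (D : irr_data G)
    (l : Irr D -> R) : Prop :=
  exists p : {poly R}, forall n : nat,
    (\esum_(alpha in [set alpha | n%:R - 1 < l alpha <= n%:R]%R)
       ((dimI alpha)%:R ^+ 2)%:E <= (p.[n%:R])%:E)%E.

Definition poly_growth (R : realType) (G : dqg R) (D : irr_data G) : Prop :=
  exists2 l : Irr D -> R, length_function l & poly_growth_wrt l.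

(* Main.v *)
Require Import Defs.
From HB Require Import structures.
From mathcomp Require Import all_boot all_order all_algebra complex finmap.
From mathcomp Require Import all_classical all_reals all_analysis.
From mathcomp Require Import ring lra.
Set Implicit Arguments.
Unset Strict Implicit.
Unset Printing Implicit Defensive.
Import Order.TTheory GRing.Theory Num.Theory.
Import numFieldNormedType.Exports.
Local Open Scope classical_set_scope.
Local Open Scope ring_scope.
Local Open Scope sesquilinear_scope.

(** By complete reducibility the coefficients of the irreducible corepresentations
    span C[G], so the Fourier transform of [f] is
    [\sum_alpha dim_q(alpha) \sum_(i, j) (f F)_ji X^alpha_ij].

    (a) Unitarity gives [\sum_(i, j) ||X^alpha_ij b||^2 = dim(alpha) ||b||^2] in the
    GNS space. A Cauchy-Schwarz inequality with weights
    [dim(alpha) (1 + l(alpha))^(-2s)] then bounds the operator norm of the Fourier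
    transform by [||f||_(2,s)] times the square root of
    [\sum_alpha dim(alpha)^2 (1 + l(alpha))^(-2s)], a sum that is finite for large [s]
    under polynomial growth.

    (b) In the amenable case the counit is a character of C*_r(G), hence contractive.
    For a finite set [A] of irreducibles with [n - 1 < l <= n], choose [f] whose
    Fourier transform is the sum of [dim(alpha) chi_alpha] over [A]. With
    [N = \sum_(alpha in A) dim(alpha)^2] the counit takes the value [N] there, while
    [||f||_(2,s)^2 <= (1 + n)^(2s) N], so property RD gives
    [N <= c^2 (1 + n)^(2s)]. *)

(** * Complete reducibility *)

Lemma star0 (R : realType) (A : cstarAlg R) : star (0 : A) = 0.
Proof. by apply: (addrI (star (0 : A))); rewrite -starD !addr0. Qed.

Lemma star1 (R : realType) (A : cstarAlg R) : star (1 : A) = 1.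
Proof. by rewrite -[LHS]mulr1 -{2}[1]starK -starM mulr1 starK. Qed.

Lemma star_sum (R : realType) (A : cstarAlg R) (I : Type) (r : seq I)
    (P : pred I) (F : I -> A) :
  star (\sum_(i <- r | P i) F i) = \sum_(i <- r | P i) star (F i).
Proof. exact: (big_morph _ (@starD _ _) (@star0 _ _)). Qed.

Lemma star_hom_sumZ (R : realType) (A B : cstarAlg R) (f : A -> B) :
  star_hom f -> forall (I : Type) (r : seq I) (c : I -> R[i]) (F : I -> A),
  f (\sum_(i <- r) c i *: F i) = \sum_(i <- r) c i *: f (F i).
Proof.
move=> hf I r c F.
have f0 : f 0 = 0 by rewrite -(scale0r 0) (star_homZ hf) // scale0r.
rewrite (big_morph f (fun x y => @star_homD _ _ _ _ _ hf x y Logic.I Logic.I) f0).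
by apply: eq_bigr => i _; rewrite (star_homZ hf).
Qed.

Lemma adjA_mul (R : realType) (A : cstarAlg R) m n p
    (X : 'M[A]_(m, n)) (Y : 'M[A]_(n, p)) :
  adjA (X *m Y) = adjA Y *m adjA X.
Proof.
apply/matrixP => i j; rewrite !mxE star_sum.
by apply: eq_bigr => k _; rewrite !mxE starM.
Qed.

Lemma adjA_scA (R : realType) (A : cstarAlg R) m n (M : 'M[R[i]]_(m, n)) :
  adjA (scA A M) = scA A (M^t* ).
Proof. by apply/matrixP => i j; rewrite !mxE starZ star1. Qed.

Lemma scA_mul (R : realType) (A : cstarAlg R) m n p
    (M : 'M[R[i]]_(m, n)) (N : 'M[R[i]]_(n, p)) :
  scA A (M *m N) = scA A M *m scA A N.
Proof. exact: map_mxM. Qed.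

Lemma scA1 (R : realType) (A : cstarAlg R) n : scA A (1%:M : 'M[R[i]]_n) = 1%:M.
Proof. exact: map_mx1. Qed.

(** Written as one sum over pairs of indices, the entries become linear combinations of entries of
    [X], to which the antipode, a homomorphism or [lin_span_sumZ] can be applied. *)
Lemma scA_sandwich (R : realType) (A : cstarAlg R) m n p q
    (M : 'M[R[i]]_(m, n)) (X : 'M[A]_(n, p)) (N : 'M[R[i]]_(p, q)) i j :
  (scA A M *m X *m scA A N) i j =
  \sum_(u : 'I_n * 'I_p) (M i u.1 * N u.2 j) *: X u.1 u.2.
Proof.
rewrite mxE; under eq_bigr => k _ do rewrite !mxE mulr_suml.
rewrite exchange_big pair_big /=; apply: eq_bigr => -[a b] _ /=.
by rewrite !mxE -scalerAl mul1r -scalerAr mulr1 scalerA mulrC.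
Qed.

Lemma lin_span_fin (R : realType) (V : lmodType R[i]) (E : set V)
    (I : finType) (c : I -> R[i]) (e : I -> V) :
  (forall k, E (e k)) -> lin_span E (\sum_k c k *: e k).
Proof.
move=> Ee; exists #|I|, (c \o enum_val), (e \o enum_val); split=> [k|].
  exact: Ee.
by rewrite (reindex (@enum_val I predT)) //=; apply/onW_bij/enum_val_bij.
Qed.

Lemma lin_span0 (R : realType) (V : lmodType R[i]) (E : set V) : lin_span E 0.
Proof. by exists 0, (fun=> 0), (fun=> 0); rewrite big_ord0; split=> // -[]. Qed.

Lemma lin_spanD (R : realType) (V : lmodType R[i]) (E : set V) x y :
  lin_span E x -> lin_span E y -> lin_span E (x + y).
Proof.
move=> [m [c [e [Ee ->]]]] [n [d [g [Eg ->]]]].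
pose C (u : 'I_m + 'I_n) := match u with inl i => c i | inr i => d i end.
pose F (u : 'I_m + 'I_n) := match u with inl i => e i | inr i => g i end.
have : lin_span E (\sum_u C u *: F u) by apply: lin_span_fin => -[k|k] /=.
by rewrite big_sumType.
Qed.

Lemma lin_spanZ (R : realType) (V : lmodType R[i]) (E : set V) (a : R[i]) x :
  lin_span E x -> lin_span E (a *: x).
Proof.
move=> [m [c [e [Ee ->]]]]; rewrite scaler_sumr.
by under eq_bigr => k _ do rewrite scalerA; apply: lin_span_fin.
Qed.

Lemma lin_span_sumZ (R : realType) (V : lmodType R[i]) (E : set V) (I : Type)
    (r : seq I) (c : I -> R[i]) (e : I -> V) :
  (forall k, lin_span E (e k)) -> lin_span E (\sum_(k <- r) c k *: e k).
Proof.
move=> Ee; apply: big_ind => [||k _]; [exact: lin_span0|exact: lin_spanD|].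
exact: lin_spanZ.
Qed.

Lemma lin_span_incl (R : realType) (V : lmodType R[i]) (E : set V) x :
  E x -> lin_span E x.
Proof.
move=> Ex; exists 1, (fun=> 1), (fun=> x); split => //.
by rewrite big_ord1 scale1r.
Qed.

(** * Counit and antipode on matrix coefficients *)

Lemma coeffs_cmx (R : realType) (G : hopfCstar R) (X : ucorep G) i j :
  coeffs G (cmx X i j).
Proof. by apply: lin_span_incl; exists X, i, j. Qed.

(** The counit axiom reads [e X = X] for the scalar matrix [e] of counit values, and [X] is
    invertible. *)
Lemma counit_cmx (R : realType) (G : dqg R) (X : ucorep G) i j :
  counit (cmx X i j : G) = (i == j)%:R.
Proof.
pose e : 'M[R[i]]_(cdim X) := \matrix_(i, j) counit (cmx X i j : G).
have eX : scA G e *m cmx X = cmx X.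
  apply/matrixP => a b; rewrite mxE.
  have [+ _ _ _] := @hopf_axioms _ G _ _ (fun k => cmx X a k)
    (fun k => cmx X k b) (coeffs_cmx a b)
    (fun k => coeffs_cmx a k) (fun k => coeffs_cmx k b) (cmx_corep a b).
  move=> <-; apply: eq_bigr => k _.
  by rewrite !mxE -scalerAl mul1r.
have : scA G e = 1%:M.
  by rewrite -[LHS]mulmx1 -(cmx_unitaryr X) mulmxA eX.
move=> /matrixP/(_ i j); rewrite !mxE -(scaler_nat _ 1).
exact: (fmorph_inj (in_alg G)).
Qed.

Lemma antipode0 (R : realType) (G : dqg R) : antipode (0 : G) = 0.
Proof.
by rewrite -[X in antipode X](scale0r 0) antipodeZ ?scale0r //; exact: lin_span0.
Qed.

Lemma antipode_sumZ (R : realType) (G : dqg R) (I : Type) (r : seq I)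
    (c : I -> R[i]) (e : I -> G) : (forall k, coeffs G (e k)) ->
  antipode (\sum_(k <- r) c k *: e k) = \sum_(k <- r) c k *: antipode (e k).
Proof.
move=> ce; elim: r => [|k r IH].
  by rewrite !big_nil antipode0.
rewrite !big_cons antipodeD ?antipodeZ ?IH //; first exact: (lin_spanZ _ (ce k)).
exact: lin_span_sumZ.
Qed.

(** The antipode axiom makes [S] a left inverse of the unitary [X], hence equal to its adjoint. *)
Lemma antipode_cmx (R : realType) (G : dqg R) (X : ucorep G) i j :
  antipode (cmx X i j : G) = star (cmx X j i : G).
Proof.
pose S : 'M[G]_(cdim X) := map_mx (@antipode R G) (cmx X).
have SX : S *m cmx X = 1%:M.
  apply/matrixP => a b; rewrite mxE.
  have [_ _ + _] := @hopf_axioms _ G _ _ (fun k => cmx X a k)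
    (fun k => cmx X k b) (coeffs_cmx a b)
    (fun k => coeffs_cmx a k) (fun k => coeffs_cmx k b) (cmx_corep a b).
  rewrite counit_cmx mxE scaler_nat => <-; apply: eq_bigr => k _.
  by rewrite !mxE.
have : S = adjA (cmx X).
  by rewrite -[LHS]mulmx1 -(cmx_unitaryr X) mulmxA SX mul1mx.
by move=> /matrixP/(_ i j); rewrite !mxE.
Qed.

(* The antipode turns [X] into [X^*] entrywise, so that [q X p = 0] yields
   [q X^* p = 0], hence [p X q = 0] when [p] and [q] are selfadjoint. *)
Lemma invariant_proj_comm (R : realType) (G : dqg R) (X : ucorep G)
    (p : 'M[R[i]]_(cdim X)) : p^t* = p ->
  cmx X *m scA G p = scA G p *m cmx X *m scA G p ->
  scA G p *m cmx X = cmx X *m scA G p.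
Proof.
move=> ph Xp; set q := 1%:M - p.
have qh : q^t* = q.
  by rewrite /q linearB /= trmx1 map_mxB map_mx1 ph.
have qE : scA G q = 1%:M - scA G p by rewrite /q /scA map_mxB map_mx1.
have qXp : scA G q *m cmx X *m scA G p = 0.
  by rewrite qE mulmxBl mul1mx mulmxBl Xp subrr.
have qSp : scA G q *m adjA (cmx X) *m scA G p = 0.
  apply/matrixP => i j; rewrite scA_sandwich mxE.
  transitivity (antipode (0 : G)).
    have /matrixP/(_ i j) := qXp; rewrite scA_sandwich mxE => E0.
    rewrite -[X in antipode X]E0 antipode_sumZ => [|u]; last exact: coeffs_cmx.
    by apply: eq_bigr => u _; rewrite antipode_cmx !mxE.
  exact: antipode0.
have pXq : scA G p *m cmx X *m scA G q = 0.
  have /(congr1 (@adjA _ _ _ _)) := qSp.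
  rewrite !adjA_mul !adjA_scA ph qh mulmxA.
  have -> : adjA (adjA (cmx X)) = cmx X by apply/matrixP => i j; rewrite !mxE starK.
  by move=> ->; apply/matrixP => i j; rewrite !mxE star0.
by move: pXq; rewrite qE mulmxBr mulmx1 -Xp => /eqP; rewrite subr_eq0 => /eqP.
Qed.

Lemma map_star_hom_sandwich (R : realType) (A B : cstarAlg R) (f : A -> B) m n p q
    (M : 'M[R[i]]_(m, n)) (X : 'M[A]_(n, p)) (N : 'M[R[i]]_(p, q)) :
  star_hom f ->
  map_mx f (scA A M *m X *m scA A N) = scA B M *m map_mx f X *m scA B N.
Proof.
move=> hf; apply/matrixP => i j; rewrite mxE !scA_sandwich star_hom_sumZ //.
by apply: eq_bigr => u _; rewrite mxE.
Qed.

(** * Splitting off subcorepresentations *)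

Lemma trCmxM (R : realType) m n p (A : 'M[R[i]]_(m, n)) (B : 'M[R[i]]_(n, p)) :
  (A *m B)^t* = B^t* *m A^t*.
Proof. by rewrite trmx_mul map_mxM. Qed.

(** The subcorepresentation is the compression [U X U^*], where [U^*] is an isometry onto the range
    of [p]; commutation of [X] with [p] makes it a unitary corepresentation. The conclusion retains
    what the induction on dimension needs: the size [r], and the entries of [X p] as combinations of
    the new coefficients. *)
Lemma subcorep (R : realType) (G : hopfCstar R) (X : ucorep G) r
    (U : 'M[R[i]]_(r, cdim X)) (p := U^t* *m U) :
  U *m U^t* = 1%:M -> scA G p *m cmx X = cmx X *m scA G p ->
  exists (Y : ucorep G) (V : 'M[R[i]]_(cdim X, cdim Y))
    (W : 'M[R[i]]_(cdim Y, cdim X)),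
    cdim Y = r /\ cmx X *m scA G p = scA G V *m cmx Y *m scA G W.
Proof.
move=> UU pX.
pose Y := scA G U *m cmx X *m scA G (U^t* ).
have UUs : scA G U *m scA G (U^t* ) = 1%:M by rewrite -scA_mul UU scA1.
have pE : scA G (U^t* ) *m scA G U = scA G p by rewrite -scA_mul.
have Up : scA G U *m scA G p = scA G U by rewrite -pE mulmxA UUs mul1mx.
have adjY : adjA Y = scA G U *m adjA (cmx X) *m scA G (U^t* ).
  by rewrite /Y !adjA_mul !adjA_scA trmxCK mulmxA.
have pXs : adjA (cmx X) *m scA G p = scA G p *m adjA (cmx X).
  have /(congr1 (@adjA _ _ _ _)) := pX.
  by rewrite !adjA_mul !adjA_scA trCmxM trmxCK.
have Yl : adjA Y *m Y = 1%:M.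
  rewrite adjY /Y !mulmxA -(mulmxA _ (scA G (U^t* )) (scA G U)) pE.
  rewrite -(mulmxA _ _ (scA G p)) pXs mulmxA Up -(mulmxA _ _ (cmx X)).
  by rewrite cmx_unitaryl mulmx1.
have Yr : Y *m adjA Y = 1%:M.
  rewrite adjY /Y !mulmxA -(mulmxA _ (scA G (U^t* )) (scA G U)) pE.
  rewrite -(mulmxA _ _ (scA G p)) -pX mulmxA Up -(mulmxA _ _ (adjA _)).
  by rewrite cmx_unitaryr mulmx1.
have corepX : map_mx (@Delta _ G) (cmx X) =
    map_mx (@leg1 _ G) (cmx X) *m map_mx (@leg2 _ G) (cmx X).
  apply/matrixP => i j; rewrite !mxE cmx_corep.
  by apply: eq_bigr => k _; rewrite !mxE.
have [[h1 h2 _ _] _ _] := legs_min G.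
have pX2 : scA _ p *m map_mx (@leg2 _ G) (cmx X) =
    map_mx (@leg2 _ G) (cmx X) *m scA _ p.
  have /(congr1 (map_mx (@leg2 _ G))) := pX.
  (* Identity matrices are inserted to give both sides the shape required by
     [map_star_hom_sandwich]. *)
  rewrite -[X in scA _ p *m X]mulmx1 -{1}(scA1 G) mulmxA.
  rewrite -{2}[cmx X]mul1mx -(scA1 G) !map_star_hom_sandwich //.
  by rewrite !scA1 mulmx1 mul1mx.
have corepY : map_mx (@Delta _ G) Y =
    map_mx (@leg1 _ G) Y *m map_mx (@leg2 _ G) Y.
  rewrite /Y !map_star_hom_sandwich //; last exact: Delta_hom.
  (* The middle factor [U^* U = p] moves past the second leg and is absorbed by the last [U^*]. *)
  rewrite corepX !mulmxA -(mulmxA _ (scA _ (U^t* )) (scA _ U)) -scA_mul -/p.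
  rewrite -(mulmxA _ (scA _ p)) pX2 -!mulmxA -scA_mul.
  by rewrite /p -mulmxA UU mulmx1.
have corepY' i j : Delta (Y i j) = \sum_(k < r) leg1 (Y i k) * leg2 (Y k j).
  have /matrixP/(_ i j) := corepY; rewrite !mxE => ->.
  by apply: eq_bigr => k _; rewrite !mxE.
exists (UCorep Yl Yr corepY'), (U^t* ), U; split=> //=.
rewrite /Y !mulmxA pE -!mulmxA pE mulmxA pX -mulmxA -scA_mul /p.
by rewrite -mulmxA (mulmxA U) UU mul1mx.
Qed.

(** Gram-Schmidt on a row basis of [p] gives [U] with orthonormal rows; then [U^* U] and [p] are
    orthogonal projections with the same row space. *)
Lemma projection_decomp (R : realType) n (p : 'M[R[i]]_n) :
  p^t* = p -> p *m p = p ->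
  exists r (U : 'M[R[i]]_(r, n)), U *m U^t* = 1%:M /\ U^t* *m U = p.
Proof.
move=> ph pp; exists (\rank p), (schmidt (row_base p)).
set U := schmidt _.
have UU : U *m U^t* = 1%:M by apply/unitarymxP/schmidt_unitarymx/rank_leq_col.
have Up : (U :=: p)%MS.
  exact: eqmx_trans (eqmx_schmidt_free (row_base_free p)) (eq_row_base p).
split=> //.
have /submxP[D DE] : (p <= U)%MS by rewrite Up.
have /submxP[E EE] : (U <= p)%MS by rewrite Up.
have UpU : U *m p = U by rewrite EE -mulmxA pp.
have pUU : p *m (U^t* *m U) = p by rewrite {1}DE !mulmxA -(mulmxA D) UU mulmx1 -DE.
(* The adjoint of [p U^* U = p] is [U^* U p = p], and [U p = U] reduces its left side to [U^* U]. *)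
have := congr1 (fun M => M^t* ) pUU.
by rewrite !trCmxM trmxCK ph -mulmxA UpU.
Qed.

(** Induction on a bound for the dimension. A reducible [X] has a nontrivial invariant projection
    [p], which commutes with [X], so [X = X p + X q] with [q = 1 - p] and both summands come from
    smaller corepresentations. *)
Lemma coeffs_span_irr (R : realType) (G : dqg R) (D : irr_data G) (a : G) :
  coeffs G a ->
  lin_span [set a | exists alpha i j, a = cmx (@rep _ _ D alpha) i j] a.
Proof.
set E := [set a | _].
suff H N (X : ucorep G) : (cdim X <= N)%N -> forall i j, lin_span E (cmx X i j).
  move=> [n [c [e [he ->]]]]; apply: lin_span_sumZ => k.
  by have [X [i [j ->]]] := he k; apply: (H (cdim X)).
elim: N X => [|N IH] X XN i j.
  by move: XN; rewrite leqn0 => /eqP X0; have := ltn_ord i; rewrite [X in (_ < X)%N]X0.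
have [/rep_surj Xirr|] := pselect (irreducible X).
  have [alpha [T [T' [_ T'T TX]]]] := Xirr D.
  have : cmx X = scA G T' *m cmx (rep alpha) *m scA G T.
    by rewrite -mulmxA -TX mulmxA -scA_mul T'T scA1 mul1mx.
  move=> ->; rewrite scA_sandwich; apply: lin_span_sumZ => u.
  by apply: lin_span_incl; exists alpha, u.1, u.2.
move=> Xnirr.
have [p [ph pp Xp p0 p1]] : exists p : 'M[R[i]]_(cdim X),
    [/\ p^t* = p, p *m p = p,
     cmx X *m scA G p = scA G p *m cmx X *m scA G p, p <> 0 & p <> 1%:M].
  (* The index [i] shows that the dimension is positive, so irreducibility can only fail through a
     projection. *)
  apply: contrapT => np; apply: Xnirr; split.
    exact: leq_ltn_trans (ltn_ord i).
  move=> p ph pp Xp; have [|p0] := pselect (p = 0); first by left.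
  have [|p1] := pselect (p = 1%:M); first by right.
  by exfalso; apply: np; exists p.
have pX := invariant_proj_comm ph Xp.
pose q := 1%:M - p.
have qh : q^t* = q by rewrite /q linearB /= trmx1 map_mxB map_mx1 ph.
have qq : q *m q = q.
  by rewrite /q mulmxBl mul1mx mulmxBr mulmx1 pp subrr subr0.
have qE : scA G q = 1%:M - scA G p by rewrite /q /scA map_mxB map_mx1.
have qX : scA G q *m cmx X = cmx X *m scA G q.
  by rewrite qE mulmxBl mulmxBr pX mul1mx mulmx1.
have [r [U [UU Up]]] := projection_decomp ph pp.
have [s [V [VV Vq]]] := projection_decomp qh qq.
(* Compare traces: [p] has trace [r], [q] has trace [s], and they add up to the identity. *)
have rs : (r + s)%N = cdim X.
  have /eqP := congr1 (@mxtrace _ _) (subrK p 1%:M).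
  rewrite -/q -{1}Vq -Up mxtraceD (mxtrace_mulC _ V) (mxtrace_mulC _ U) UU VV.
  by rewrite !mxtrace1 -natrD eqr_nat addnC => /eqP.
have r0 : (0 < r)%N.
  rewrite lt0n; apply/eqP => r0; apply: p0; rewrite -Up; subst r.
  by rewrite (flatmx0 U) mulmx0.
have s0 : (0 < s)%N.
  rewrite lt0n; apply/eqP => s0; apply: p1; apply/esym/eqP.
  by rewrite -subr_eq0 -/q -Vq; subst s; rewrite (flatmx0 V) mulmx0.
have -> : cmx X = cmx X *m scA G p + cmx X *m scA G q.
  by rewrite -mulmxDr qE addrC subrK mulmx1.
have [Y [A [B [Yr ->]]]] : exists (Y : ucorep G) (V : 'M[R[i]]_(cdim X, cdim Y))
    (W : 'M[R[i]]_(cdim Y, cdim X)),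
    cdim Y = r /\ cmx X *m scA G p = scA G V *m cmx Y *m scA G W.
  by rewrite -Up; apply: subcorep => //; rewrite Up.
have [Z [A' [B' [Zs ->]]]] : exists (Y : ucorep G) (V : 'M[R[i]]_(cdim X, cdim Y))
    (W : 'M[R[i]]_(cdim Y, cdim X)),
    cdim Y = s /\ cmx X *m scA G q = scA G V *m cmx Y *m scA G W.
  by rewrite -Vq; apply: subcorep => //; rewrite Vq.
rewrite mxE !scA_sandwich; apply: lin_spanD; apply: lin_span_sumZ => u; apply: IH.
  by rewrite Yr -ltnS (leq_trans _ XN) // -rs -addn1 leq_add2l.
by rewrite Zs -ltnS (leq_trans _ XN) // -rs -add1n leq_add2r.
Qed.

(** * The Fourier transform *)

Lemma pairing_sumZ (R : realType) (G : dqg R) (D : irr_data G) (h : CG D)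
    (I : Type) (r : seq I) (c : I -> R[i]) (e : I -> G) :
  (forall k, coeffs G (e k)) ->
  pairing h (\sum_(k <- r) c k *: e k) = \sum_(k <- r) c k * pairing h (e k).
Proof.
move=> ce; elim: r => [|k r IH]; last first.
  by rewrite !big_cons pairing_lin ?IH //; exact: lin_span_sumZ.
rewrite !big_nil; have c0 : coeffs G 0 by exact: lin_span0.
(* The value at zero follows from additivity at [0 + 0]. *)
have := pairing_lin h 1 c0 c0; rewrite scaler0 addr0 mul1r => h0.
by apply/eqP; rewrite -[_ == 0](inj_eq (addrI (pairing h 0))) -h0 addr0.
Qed.

Definition coeff_index (R : realType) (G : dqg R) (D : irr_data G) :=
  {alpha : Irr D & ('I_(cdim (rep alpha)) * 'I_(cdim (rep alpha)))%type}.

Definition irr_coeff (R : realType) (G : dqg R) (D : irr_data G)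
    (t : coeff_index D) : G := cmx (rep (tag t)) (tagged t).1 (tagged t).2.

(** The matrix unit at position [t]. Under the pairing these are the functionals dual to the
    coefficients [irr_coeff]. *)
Definition unit_CG (R : realType) (G : dqg R) (D : irr_data G)
    (t : coeff_index D) : CG D :=
  fun beta => \matrix_(i, j) (((existT _ beta (i, j) : coeff_index D) == t)%:R).

Lemma unit_CG_Cc (R : realType) (G : dqg R) (D : irr_data G)
    (t : coeff_index D) : in_Cc (unit_CG t).
Proof.
apply: (@sub_finite_set _ _ [set tag t]) => [beta /= /eqP nz|]; last first.
  exact: finite_set1.
apply: contrapT => bt; apply: nz; apply/matrixP => i j; rewrite !mxE.
by case: eqP => // tE; case: bt; rewrite -tE.
Qed.

Lemma pairing_unit (R : realType) (G : dqg R) (D : irr_data G)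
    (t u : coeff_index D) : pairing (unit_CG t) (irr_coeff u) = (u == t)%:R.
Proof. by rewrite pairing_coeff mxE; case: u => a [i j]. Qed.

(** Pairing with matrix units reads off the coordinates of [a] on irreducible coefficients. This
    yields the uniqueness behind [xget] in [fourier]. *)
Lemma pairing_separates (R : realType) (G : dqg R) (D : irr_data G) (a : G) :
  coeffs G a -> (forall h : CG D, in_Cc h -> pairing h a = 0) -> a = 0.
Proof.
move=> /(coeffs_span_irr D) [n [c [e [he ->]]]] h0.
have /choice[t te] : forall k, exists t : coeff_index D, e k = irr_coeff t.
  by move=> k; have [alpha [i [j ->]]] := he k; exists (existT _ alpha (i, j)).
(* The combination may repeat a coefficient, so its terms are first collected over the distinct
   indices. *)
pose S := undup [seq t k | k <- enum 'I_n].
have tS k : t k \in S by rewrite mem_undup map_f // mem_enum.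
have -> : \sum_k c k *: e k =
    \sum_(u <- S) (\sum_k c k * (t k == u)%:R) *: irr_coeff u.
  under [RHS]eq_bigr => u _ do rewrite scaler_suml.
  rewrite exchange_big /=; apply: eq_bigr => k _.
  rewrite (bigD1_seq (t k)) ?undup_uniq ?tS //= eqxx mulr1 te big1 ?addr0 //.
  by move=> u; rewrite eq_sym => /negbTE ->; rewrite mulr0 scale0r.
rewrite big1_seq // => u _.
have /= := h0 _ (unit_CG_Cc u); rewrite pairing_sumZ => [h|k]; last first.
  by rewrite te; exact: coeffs_cmx.
rewrite -[X in X *: _ = _](_ : \sum_k c k * pairing (unit_CG u) (e k) = _).
  by rewrite h scale0r.
by apply: eq_bigr => k _; rewrite te pairing_unit.
Qed.

(** Cyclicity turns [tr (F h f)] into [tr (h f F)], whence the transposed indices of [f F]. The set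
    [A] may be larger than the support of [f]. *)
Lemma phi_mulCG (R : realType) (G : dqg R) (D : irr_data G)
    (A : {fset Irr D}) (h f : CG D) :
  (forall alpha, alpha \notin A -> f alpha = 0) ->
  phi (mulCG h f) = \sum_(alpha <- A) dimq alpha *
    \sum_u (f alpha *m modF alpha) u.2 u.1 * h alpha u.1 u.2.
Proof.
move=> fA; rewrite /phi (fsbigTE A) => [|alpha /fA fa]; last first.
  by rewrite /mulCG fa !mulmx0 mxtrace0 mulr0.
apply: eq_bigr => alpha _; rewrite mxtrace_mulC -mulmxA /mulCG.
rewrite -(pair_bigA _ (fun i j => (f alpha *m modF alpha) j i * h alpha i j)) /=.
congr (_ * _); apply: eq_bigr => i _; rewrite mxE.
by apply: eq_bigr => j _; rewrite mulrC.
Qed.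

(** The sum lies in C[G] and has the pairings demanded by [fourier]; [pairing_separates] makes it
    the only such element. *)
Lemma fourierE (R : realType) (G : dqg R) (D : irr_data G)
    (A : {fset Irr D}) (f : CG D) :
  (forall alpha, alpha \notin A -> f alpha = 0) ->
  fourier f = \sum_(alpha <- A) dimq alpha *:
    \sum_u (f alpha *m modF alpha) u.2 u.1 *: (cmx (rep alpha) u.1 u.2 : G).
Proof.
move=> fA.
set x := \sum_(alpha <- A) _.
have xc : coeffs G x.
  apply: lin_span_sumZ => alpha; apply: lin_span_sumZ => u; exact: coeffs_cmx.
have hx h : pairing h x = phi (mulCG h f).
  rewrite (phi_mulCG _ fA) pairing_sumZ => [|alpha]; last first.
    by apply: lin_span_sumZ => u; exact: coeffs_cmx.
  apply: eq_bigr => alpha _; rewrite pairing_sumZ => [|u]; last first.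
    exact: coeffs_cmx.
  by congr (_ * _); apply: eq_bigr => u _; rewrite pairing_coeff.
apply: xget_unique => [|y [yc hy]]; first by split.
apply/eqP; rewrite -subr_eq0; apply/eqP; apply: (@pairing_separates _ _ D).
  by apply: lin_spanD => //; rewrite -scaleN1r; exact: lin_spanZ.
move=> h hc; rewrite addrC -scaleN1r pairing_lin // hx hy //.
by rewrite mulN1r addNr.
Qed.

(** * Polynomial growth implies rapid decay *)

(* Lagrange's identity: twice the difference of the two sides is
   [\sum_(k, l) h (star y_kl * y_kl) / (w k * w l)] with
   [y_kl = (c l)^* w k x_k - (c k)^* w l x_l]. *)
Lemma gns_weighted_CS (R : realType) (A : cstarAlg R) (h : {scalar A})
    (I : Type) (r : seq I) (c w : I -> R[i]) (x : I -> A) :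
  (forall a, 0 <= h (star a * a)) -> (forall k, 0 < w k) ->
  h (star (\sum_(k <- r) c k *: x k) * \sum_(k <- r) c k *: x k) <=
  (\sum_(k <- r) `|c k| ^+ 2 / w k) *
  (\sum_(k <- r) w k * h (star (x k) * x k)).
Proof.
move=> h0 w0.
pose B k l := h (star (x k) * x l).
pose y k l := ((c l)^* * w k) *: x k - ((c k)^* * w l) *: x l.
have wC k : (w k)^* = w k by apply/CrealP/gtr0_real.
have yE k l : h (star (y k l) * y k l) / (w k * w l) =
    `|c l| ^+ 2 / w l * (w k * B k k) + `|c k| ^+ 2 / w k * (w l * B l l)
    - (c l * (c k)^* * B k l + c k * (c l)^* * B l k).
  have wn k' : w k' != 0 by rewrite gt_eqF.
  have starN z : star (- z : A) = - star z.
    by rewrite -scaleN1r starZ rmorphN1 scaleN1r.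
  rewrite /y starD starN !starZ !rmorphM /= !conjCK !wC mulrDl !mulrDr.
  rewrite !mulNr !mulrN opprK -!scalerAl -!scalerAr !scalerA !linearD !linearN /=.
  rewrite !linearZ /= -!/(B _ _) !normCK /GRing.scale /=.
  by field; rewrite !wn.
rewrite -(ler_pM2l (ltr0Sn _ 1)) -subr_ge0.
suff -> : 2 * ((\sum_(k <- r) `|c k| ^+ 2 / w k) *
      (\sum_(k <- r) w k * h (star (x k) * x k))) -
    2 * h (star (\sum_(k <- r) c k *: x k) * \sum_(k <- r) c k *: x k) =
    \sum_(k <- r) \sum_(l <- r) h (star (y k l) * y k l) / (w k * w l).
  apply: sumr_ge0 => k _; apply: sumr_ge0 => l _.
  by rewrite divr_ge0 ?mulr_ge0 // ltW.
under [RHS]eq_bigr => k _ do under eq_bigr => l _ do rewrite yE.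
have hE : h (star (\sum_(k <- r) c k *: x k) * \sum_(k <- r) c k *: x k) =
    \sum_(k <- r) \sum_(l <- r) c l * (c k)^* * B k l.
  rewrite star_sum mulr_suml linear_sum; apply: eq_bigr => k _.
  rewrite mulr_sumr linear_sum; apply: eq_bigr => l _.
  by rewrite starZ -scalerAl -scalerAr scalerA linearZ /= [X in X * _]mulrC.
have PE : (\sum_(k <- r) `|c k| ^+ 2 / w k) *
      (\sum_(k <- r) w k * h (star (x k) * x k)) =
    \sum_(k <- r) \sum_(l <- r) `|c k| ^+ 2 / w k * (w l * B l l).
  by rewrite mulr_suml; apply: eq_bigr => k _; rewrite mulr_sumr.
rewrite hE PE !mulr2n !mulrDl !mul1r.
under [RHS]eq_bigr => k _ do rewrite !(big_split, sumrN) /=.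
rewrite !(big_split, sumrN) /=.
(* The two squared terms, and likewise the two cross terms, differ by the exchange of [k] and
   [l]. *)
congr (_ + _ - (_ + _)); exact: exchange_big.
Qed.

Lemma gns_norm_le (R : realType) (A : cstarAlg R) (h : {scalar A}) (a : A) (M : R) :
  (forall x, 0 <= h (star x * x)) -> 0 <= M ->
  (forall b, h (star (a * b) * (a * b)) <= (M ^+ 2)%:C%C * h (star b * b)) ->
  gns_norm h a <= M.
Proof.
move=> h0 M0 hM; apply: ge_sup.
  (* The zero vector shows that the set under the supremum is nonempty. *)
  exists (Num.sqrt (complex.Re (h (star (a * 0) * (a * 0))))), 0 => //=.
  by rewrite mulr0 linear0 /= ler01.
move=> _ [b /= hb <-].
rewrite -(ger0_norm M0) -sqrtr_sqr ler_wsqrtr //.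
have := hM b; rewrite lecE => /andP[_].
rewrite -[h (star b * b)]RRe_real ?ger0_real // -rmorphM /= => /le_trans; apply.
by rewrite ler_piMr // sqr_ge0.
Qed.

(** Each column [j] satisfies [\sum_i star (X i j) * X i j = 1], and there are [cdim X] columns. *)
Lemma sum_irr_coeff_sqr (R : realType) (G : hopfCstar R) (X : ucorep G)
    (h : {scalar G}) (b : G) :
  \sum_(u : 'I_(cdim X) * 'I_(cdim X))
    h (star (cmx X u.1 u.2 * b) * (cmx X u.1 u.2 * b)) =
  (cdim X)%:R * h (star b * b).
Proof.
rewrite -(pair_bigA _ (fun i j => h (star (cmx X i j * b) * (cmx X i j * b)))) /=.
rewrite exchange_big /=.
have -> : (cdim X)%:R * h (star b * b) = \sum_(j < cdim X) h (star b * b).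
  by rewrite sumr_const card_ord mulr_natl.
apply: eq_bigr => j _; rewrite -linear_sum; congr (h _).
have /matrixP/(_ j j) := cmx_unitaryl X; rewrite !mxE eqxx => XX.
under eq_bigr => i _ do rewrite starM -mulrA (mulrA _ _ b).
rewrite -mulr_sumr -mulr_suml -[X in _ = _ * X]mul1r -[1]XX.
by congr (_ * (_ * _)); apply: eq_bigr => i _; rewrite !mxE.
Qed.

(** * Positivity of the modular matrices and the weighted 2-norm *)

Lemma dim_gt0 (R : realType) (G : dqg R) (D : irr_data G) (alpha : Irr D) :
  (0 < dimI alpha)%N.
Proof. by have [] := rep_irr alpha. Qed.

Lemma modF_diag_gt0 (R : realType) (G : dqg R) (D : irr_data G)
    (alpha : Irr D) i : 0 < modF alpha i i.
Proof.
have := @modF_gt0 _ _ _ alpha (delta_mx i 0).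
rewrite trmx_delta map_delta_mx /= -rowE -colE !mxE; apply.
by apply/eqP => /matrixP/(_ i 0)/eqP; rewrite !mxE !eqxx oner_eq0.
Qed.

Lemma dimq_gt0 (R : realType) (G : dqg R) (D : irr_data G) (alpha : Irr D) :
  0 < dimq alpha.
Proof.
rewrite /dimq /mxtrace (bigD1 (Ordinal (dim_gt0 alpha))) //=.
by rewrite ltr_wpDr ?modF_diag_gt0 // sumr_ge0 // => i _; rewrite ltW ?modF_diag_gt0.
Qed.

Lemma modF_unit (R : realType) (G : dqg R) (D : irr_data G) (alpha : Irr D) :
  modF alpha \in unitmx.
Proof.
rewrite -unitmx_tr -row_free_unit; apply/inj_row_free => v vF.
apply/eqP; rewrite -trmx_eq0; apply/negP => /negP /modF_gt0.
rewrite -mulmxA -[modF alpha]trmxK -trmx_mul vF trmx0 mulmx0 mxE.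
by rewrite ltxx.
Qed.

(** The sum inside [norm2] is nonnegative, so taking its real part and then the square root loses
    nothing. *)
Lemma norm2E (R : realType) (G : dqg R) (D : irr_data G) (l : Irr D -> R) (s : R)
    (A : {fset Irr D}) (f : CG D) :
  (forall alpha, alpha \notin A -> f alpha = 0) ->
  ((norm2 l s f) ^+ 2)%:C%C = \sum_(alpha <- A) dimq alpha ^+ 2 /
    (dimI alpha)%:R * (((1 + l alpha) `^ s) ^+ 2)%:C%C *
    \sum_u `|(f alpha *m modF alpha) u.2 u.1| ^+ 2.
Proof.
move=> fA; rewrite /norm2 /=.
have trE alpha : \tr ((((1 + l alpha) `^ s)%:C%C *: (f alpha *m modF alpha))^t* *m
    (((1 + l alpha) `^ s)%:C%C *: (f alpha *m modF alpha))) =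
    (((1 + l alpha) `^ s) ^+ 2)%:C%C *
    \sum_u `|(f alpha *m modF alpha) u.2 u.1| ^+ 2.
  rewrite /mxtrace mulr_sumr.
  rewrite -(pair_bigA _ (fun i j => (((1 + l alpha) `^ s) ^+ 2)%:C%C *
    `|(f alpha *m modF alpha) j i| ^+ 2)) /=.
  apply: eq_bigr => i _; rewrite mxE; apply: eq_bigr => j _.
  rewrite !mxE rmorphM /= [_^*](conjc_real ((1 + l alpha) `^ s)).
  by rewrite rmorphXn /= normCK; ring.
rewrite (fsbigTE A) => [|alpha /fA fa]; last first.
  by rewrite fa mul0mx scaler0 mulmx0 mxtrace0 mulr0.
set S := \sum_(alpha <- A) _.
have S0 : 0 <= S.
  apply: sumr_ge0 => alpha _.
  rewrite trE !mulr_ge0 ?invr_ge0 ?exprn_ge0 ?(ltW (dimq_gt0 _)) //.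
    by rewrite ler0c exprn_ge0 ?powR_ge0.
  by apply: sumr_ge0 => u _; rewrite exprn_ge0.
rewrite sqr_sqrtr; last by move: S0; rewrite lecE => /andP[].
rewrite RRe_real ?ger0_real //.
by apply: eq_bigr => alpha _; rewrite trE mulrA.
Qed.

Lemma op_norm_fourier_le (R : realType) (G : dqg R) (D : irr_data G)
    (l : Irr D -> R) (s K : R) (f : CG D) :
  (forall alpha, 0 <= l alpha) ->
  (forall A : {fset Irr D},
    \sum_(alpha <- A) (dimI alpha)%:R ^+ 2 / ((1 + l alpha) `^ s) ^+ 2 <= K) ->
  in_Cc f -> op_norm (fourier f) <= Num.sqrt K * norm2 l s f.
Proof.
move=> l0 hK fc.
pose A := fset_set [set alpha | f alpha != 0].
have fA alpha : alpha \notin A -> f alpha = 0.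
  by rewrite in_fset_set // notin_setE /= => /negP; rewrite negbK => /eqP.
have K0 : 0 <= K.
  apply: le_trans (hK A); apply: sumr_ge0 => alpha _.
  by rewrite divr_ge0 ?exprn_ge0 ?powR_ge0.
apply: gns_norm_le => [x||b]; first exact: haar_ge0.
  by rewrite mulr_ge0 ?sqrtr_ge0.
pose W alpha := (1 + l alpha) `^ s.
have W0 alpha : 0 < W alpha by rewrite powR_gt0 // ltr_pwDl.
pose r := [seq (existT _ alpha u : coeff_index D) | alpha <- A,
  u <- enum (('I_(cdim (rep alpha)) * 'I_(cdim (rep alpha)))%type : finType)].
pose c (t : coeff_index D) := dimq (tag t) *
  (f (tag t) *m modF (tag t)) (tagged t).2 (tagged t).1.
(* With these weights the first Cauchy-Schwarz factor is exactly the square of [norm2 l s f]; by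
   unitarity the second is [\sum_alpha dim(alpha)^2 / W(alpha)^2] times the squared length of
   [b]. *)
pose w (t : coeff_index D) := ((dimI (tag t))%:R / (W (tag t) ^+ 2)%:C%C : R[i]).
have w0 t : 0 < w t by rewrite divr_gt0 ?ltr0n ?dim_gt0 // ltcR exprn_gt0.
have fE : fourier f * b = \sum_(t <- r) c t *: (irr_coeff t * b).
  rewrite (fourierE fA) mulr_suml big_allpairs_dep; apply: eq_bigr => alpha _.
  rewrite -scalerAl mulr_suml scaler_sumr big_enum /=; apply: eq_bigr => u _.
  by rewrite -scalerAl scalerA.
rewrite fE; apply: le_trans (gns_weighted_CS _ _ _ (@haar_ge0 _ G) w0) _.
have -> : \sum_(t <- r) `|c t| ^+ 2 / w t = ((norm2 l s f) ^+ 2)%:C%C.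
  rewrite (norm2E _ _ fA) big_allpairs_dep; apply: eq_bigr => alpha _.
  rewrite big_enum mulr_sumr; apply: eq_bigr => u _.
  rewrite /c /w /= normrM exprMn (ger0_norm (ltW (dimq_gt0 alpha))).
  by rewrite invf_div; ring.
have -> : \sum_(t <- r) w t * haar G (star (irr_coeff t * b) * (irr_coeff t * b)) =
    (\sum_(alpha <- A) (dimI alpha)%:R ^+ 2 / W alpha ^+ 2)%:C%C * haar G (star b * b).
  rewrite big_allpairs_dep rmorph_sum mulr_suml; apply: eq_bigr => alpha _.
  rewrite big_enum /w /= -mulr_sumr sum_irr_coeff_sqr.
  by rewrite fmorph_div /= !rmorphXn !rmorph_nat /=; ring.
rewrite mulrA -rmorphM /=; apply: ler_wpM2r; first exact: haar_ge0.
rewrite lecR exprMn (sqr_sqrtr K0) [leRHS]mulrC.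
by rewrite ler_wpM2l ?sqr_ge0 // hK.
Qed.

(** * Summation over the levels of the length *)

Lemma horner_nat_le (R : realType) (p : {poly R}) (n : nat) :
  p.[n%:R] <= (\sum_(i < size p) `|p`_i|) * (maxn n 1)%:R ^+ size p.
Proof.
rewrite horner_coef mulr_suml; apply: ler_sum => i _.
apply: le_trans (ler_norm _) _; rewrite normrM ler_wpM2l // normrX normr_nat.
(* A base of at least 1 makes the powers increase with the exponent, even at [n = 0]. *)
apply: (@le_trans _ _ ((maxn n 1)%:R ^+ i)).
  by rewrite lerXn2r ?nnegrE // ler_nat leq_maxl.
by rewrite ler_weXn2l ?(ltnW (ltn_ord i)) // ler1n leq_maxr.
Qed.

(** The terms at 0 and 1 are both 1; the others telescope, since
    [1 / (m+2)^2 <= 1 / (m+1) - 1 / (m+2)]. *)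
Lemma sum_invsqr_le (R : realType) (N : nat) :
  \sum_(n < N) ((maxn n 1)%:R ^+ 2)^-1 <= 3 :> R.
Proof.
have H m : \sum_(n < m.+2) ((maxn n 1)%:R ^+ 2)^-1 <= 3 - (m.+1)%:R^-1 :> R.
  elim: m => [|m IH].
    by rewrite !big_ord_recr big_ord0 /= /maxn /= expr1n invr1; lra.
  rewrite big_ord_recr /=; apply: le_trans (lerD IH (lexx _)) _.
  rewrite (maxn_idPl _) // -lerBrDl opprD opprK addrA.
  have -> : 3 - m.+2%:R^-1 - 3 + m.+1%:R^-1 = (m.+1%:R * m.+2%:R)^-1 :> R.
    by rewrite -(natr1 m.+1); field; rewrite -[1]/(1%:R) -!natrD !pnatr_eq0.
  by rewrite lef_pV2 ?posrE ?exprn_gt0 ?mulr_gt0 // expr2 ler_pM2r // ler_nat.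
apply: le_trans (_ : \sum_(n < N.+2) ((maxn n 1)%:R ^+ 2)^-1 <= _); last first.
  by apply: le_trans (H N) _; rewrite gerBl invr_ge0.
by rewrite !big_ord_recr /= -addrA lerDl addr_ge0.
Qed.

Lemma esum_ge_seq (R : realType) (T : choiceType) (S : set T) (r : seq T) (a : T -> R) :
  uniq r -> (forall x, x \in r -> S x) ->
  ((\sum_(x <- r) a x)%:E <= \esum_(x in S) (a x)%:E)%E.
Proof.
move=> ur rS; apply: esum_ge; exists [set` r].
  by split; [exact: finite_seq|move=> x /= /rS].
by rewrite -fsbig_seq // sumEFin.
Qed.

Lemma length_level (R : realType) (x : R) : 0 <= x ->
  exists n : nat, n%:R - 1 < x <= n%:R.
Proof.
move=> x0; exists `|Num.ceil x|%N.
have c0 : 0 <= Num.ceil x by rewrite ceil_ge0 (lt_le_trans _ x0) // ltrN10.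
by rewrite -[_%:R]/((`|Num.ceil x|%N : int)%:~R) gez0_abs // -(intrB _ _ 1) ceil_itv.
Qed.

Lemma poly_growth_summable (R : realType) (G : dqg R) (D : irr_data G)
    (l : Irr D -> R) :
  (forall alpha, 0 <= l alpha) -> poly_growth_wrt l ->
  exists2 s, 0 < s & exists K, forall A : {fset Irr D},
    \sum_(alpha <- A) (dimI alpha)%:R ^+ 2 / ((1 + l alpha) `^ s) ^+ 2 <= K.
Proof.
move=> l0 [p hp]; set C := \sum_(i < size p) `|p`_i|.
have C0 : 0 <= C by exact: sumr_ge0.
(* With [d = size p], level [n] contributes at most [C m^d / m^(2 d + 2) <= C / m^2], where
   [m = maxn n 1], and these bounds add up to at most [3 C]. *)
exists (size p).+1%:R => //; exists (C * 3) => A.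
have /choice[lev levE] : forall alpha, exists n : nat, n%:R - 1 < l alpha <= n%:R.
  by move=> alpha; exact: length_level.
pose m n : R := (maxn n 1)%:R.
have m1 n : 1 <= m n by rewrite ler1n leq_maxr.
have m0 n : 0 < m n by rewrite (lt_le_trans _ (m1 n)).
(* At a positive level use [n - 1 < l alpha]; at level 0, where [m] is 1, use [0 <= l alpha]. *)
have lm alpha : m (lev alpha) <= 1 + l alpha.
  have /andP[+ _] := levE alpha; rewrite /m; have := l0 alpha.
  by case: (lev alpha) => [|n]; rewrite ?max0n ?(maxn_idPl _) //; lra.
pose N := (\max_(alpha <- A) lev alpha).+1.
have levN alpha : alpha \in A -> (lev alpha < N)%N.
  by move=> aA; rewrite ltnS; exact: leq_bigmax_seq.
apply: (@le_trans _ _ (\sum_(n < N) C * (m n ^+ 2)^-1)); last first.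
  by rewrite -mulr_sumr ler_wpM2l // sum_invsqr_le.
(* Sort [A] by level; [inord] is faithful because all levels are below [N]. *)
rewrite big_seq (partition_big (fun alpha => inord (lev alpha) : 'I_N) predT) //=.
apply: ler_sum => n _.
apply: (@le_trans _ _ ((\sum_(alpha <- [seq alpha <- A | lev alpha == n])
    (dimI alpha)%:R ^+ 2) * ((m n ^+ (size p).+1) ^+ 2)^-1)).
  rewrite mulr_suml big_filter.
  rewrite [leRHS]big_seq_cond [leLHS](eq_bigl
    (fun alpha => (alpha \in A) && (lev alpha == n))); last first.
    move=> alpha; have [aA|] := boolP (alpha \in A) => //=.
    by rewrite -val_eqE /= inordK // levN.
  apply: ler_sum => alpha /andP[_ /eqP <-].
  rewrite ler_wpM2l ?sqr_ge0 // powR_mulrn ?addr_ge0 //.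
  have lm0 : 0 < 1 + l alpha by exact: lt_le_trans (lm _).
  rewrite lef_pV2 ?posrE ?exprn_gt0 //.
  by rewrite !lerXn2r ?nnegrE ?exprn_ge0 ?(ltW lm0) // ltW.
rewrite ler_pdivrMr ?exprn_gt0 //.
apply: (@le_trans _ _ p.[n%:R]).
  rewrite -lee_fin; apply: le_trans (hp n); apply: esum_ge_seq.
    by rewrite filter_uniq.
  by move=> alpha; rewrite mem_filter => /andP[/eqP <- _]; exact: levE.
apply: le_trans (horner_nat_le _ _) _; rewrite -mulrA ler_wpM2l // -/(m n).
rewrite [m n ^+ (size p).+1]exprS exprMn mulrA mulVf ?gt_eqF ?exprn_gt0 // mul1r -exprM.
by rewrite ler_weXn2l // muln2 -addnn leq_addr.
Qed.

Lemma poly_growth_rapid_decay (R : realType) (G : dqg R) (D : irr_data G)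
    (l : Irr D -> R) :
  (forall alpha, 0 <= l alpha) -> poly_growth_wrt l -> rapid_decay_wrt l.
Proof.
move=> l0 pg; have [s s0 [K hK]] := poly_growth_summable l0 pg.
(* Adding 1 makes the constant positive without a lower bound on [K]. *)
exists (Num.sqrt K + 1), s; split=> // f fc.
apply: le_trans (op_norm_fourier_le l0 hK fc) _.
by rewrite ler_wpM2r ?sqrtr_ge0 // lerDl.
Qed.

(** * Rapid decay implies polynomial growth in the amenable case *)

(** This passes from completeness in terms of filters to the epsilon form of [cnorm_complete]. *)
Lemma real_cauchy_complete (R : realType) (v : nat -> R) :
  (forall e : R, 0 < e -> exists N, forall m n,
     (N <= m)%N -> (N <= n)%N -> `|v m - v n| < e) ->
  exists x, forall e : R, 0 < e -> exists N, forall n,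
     (N <= n)%N -> `|v n - x| < e.
Proof.
move=> cv.
have /cvg_ex[x /cvgrPdist_lt vx] : cvgn v.
  apply/cauchy_cvgP/cauchy_exP => e e0; have [N hN] := cv _ e0.
  by exists (v N); exists N => // n /= Nn; exact: hN.
exists x => e e0; have [N _ hN] := vx _ e0.
by exists N => n Nn; rewrite distrC; exact: hN.
Qed.

Lemma Re_normM (R : realType) (x y : R[i]) :
  complex.Re `|x * y| = complex.Re `|x| * complex.Re `|y|.
Proof. by rewrite normrM !normc_def -rmorphM. Qed.

Lemma Re_normD (R : realType) (x y : R[i]) :
  complex.Re `|x + y| <= complex.Re `|x| + complex.Re `|y|.
Proof. by have := ler_normD x y; rewrite lecE => /andP[_]; rewrite raddfD. Qed.

Lemma Re_norm_eq0 (R : realType) (x : R[i]) : complex.Re `|x| = 0 -> x = 0.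
Proof. by move=> x0; apply/normr0_eq0; move: x0; rewrite normc_def /= => ->. Qed.

Lemma abs_Re_le (R : realType) (x : R[i]) : `|complex.Re x| <= complex.Re `|x|.
Proof. by have := normc_ge_Re x; rewrite normc_def lecR. Qed.

Lemma abs_Im_le (R : realType) (x : R[i]) : `|complex.Im x| <= complex.Re `|x|.
Proof.
rewrite normc_def /= -sqrtr_sqr ler_wsqrtr // lerDr sqr_ge0 //.
Qed.

Lemma Re_norm_le (R : realType) (x : R[i]) :
  complex.Re `|x| <= `|complex.Re x| + `|complex.Im x|.
Proof.
rewrite normc_def /= -[leRHS]ger0_norm ?addr_ge0 // -sqrtr_sqr ler_wsqrtr //.
rewrite sqrrD !real_normK ?num_real // -addrA [_ *+ 2 + _]addrC addrA lerDl.
by rewrite mulrn_wge0 ?mulr_ge0.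
Qed.

Lemma complex_cauchy_complete (R : realType) (u : nat -> R[i]) :
  (forall e : R, 0 < e -> exists N, forall m n,
     (N <= m)%N -> (N <= n)%N -> complex.Re `|u m - u n| < e) ->
  exists x, forall e : R, 0 < e -> exists N, forall n,
     (N <= n)%N -> complex.Re `|u n - x| < e.
Proof.
move=> cu.
have [a ha] : exists a, forall e : R, 0 < e -> exists N, forall n,
    (N <= n)%N -> `|complex.Re (u n) - a| < e.
  apply: real_cauchy_complete => e e0; have [N hN] := cu _ e0; exists N => m n Nm Nn.
  by rewrite -raddfB; apply: le_lt_trans (abs_Re_le _) (hN _ _ Nm Nn).
have [b hb] : exists b, forall e : R, 0 < e -> exists N, forall n,
    (N <= n)%N -> `|complex.Im (u n) - b| < e.
  apply: real_cauchy_complete => e e0; have [N hN] := cu _ e0; exists N => m n Nm Nn.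
  by rewrite -raddfB; apply: le_lt_trans (abs_Im_le _) (hN _ _ Nm Nn).
exists (a +i* b)%C => e e0.
have e20 : 0 < e / 2 by rewrite divr_gt0.
have [N hN] := ha _ e20; have [M hM] := hb _ e20.
exists (maxn N M) => n; rewrite geq_max => /andP[Nn Mn].
apply: le_lt_trans (Re_norm_le _) _; rewrite !raddfB /=.
by rewrite [ltRHS]splitr ltrD ?hN ?hM.
Qed.

(** This is the target that lets the universal property of the full C*-algebra apply to the
    counit. *)
Definition cstarC (R : realType) : cstarAlg R.
Proof.
apply: (@CStarAlg R (R[i]^o : algType R[i]) (fun x => x^*)
  (fun x => complex.Re `|x : R[i]|)).
- by move=> x y; exact: rmorphD.
- by move=> c x; exact: rmorphM.
- by move=> x y; rewrite -rmorphM /= mulrC.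
- by move=> x; exact: conjCK.
- exact: Re_norm_eq0.
- exact: Re_normD.
- exact: Re_normM.
- by move=> x y; rewrite Re_normM.
- by move=> x; rewrite Re_normM norm_conjC expr2.
- exact: complex_cauchy_complete.
Defined.

(** * Contractivity of characters and of the counit *)

Lemma cnorm0 (R : realType) (A : cstarAlg R) : cnorm (0 : A) = 0.
Proof. by rewrite -(scale0r 0) cnormZ normr0 mul0r. Qed.

Lemma cnorm_ge0 (R : realType) (A : cstarAlg R) (x : A) : 0 <= cnorm x.
Proof.
have := cnormD x (- x); rewrite subrr cnorm0 -scaleN1r cnormZ normrN1 mul1r.
by rewrite -mulr2n pmulrn_lge0.
Qed.

(* If [|chi a| > cnorm a], rescale to [chi a = 1 > cnorm a]; the Neumann series
   [b = \sum_k a ^+ k.+1] then satisfies [b = a + a * b], which [chi] contradicts. *)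
Lemma character_le_norm (R : realType) (A : cstarAlg R) (chi : A -> R[i]) (a : A) :
  (forall x y, chi (x + y) = chi x + chi y) ->
  (forall c x, chi (c *: x) = c * chi x) ->
  (forall x y, chi (x * y) = chi x * chi y) ->
  complex.Re `|chi a| <= cnorm a.
Proof.
move=> chiD chiZ chiM; rewrite leNgt; apply/negP => a_lt.
have chia0 : chi a != 0.
  apply/eqP => chia; move: a_lt; rewrite chia normr0 => /lt_geF.
  by rewrite cnorm_ge0.
pose x := (chi a)^-1 *: a.
have chix : chi x = 1 by rewrite chiZ mulVf.
have x1 : cnorm x < 1.
  have n0 : 0 < complex.Re `|chi a| by exact: le_lt_trans (cnorm_ge0 a) a_lt.
  rewrite -(ltr_pM2l n0) mulr1 cnormZ mulrA -Re_normM divff // normr1 mul1r.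
  exact: a_lt.
pose t := cnorm x; have t0 : 0 <= t by exact: cnorm_ge0.
have xn n : cnorm (x ^+ n.+1) <= t ^+ n.+1.
  elim: n => [|n IH]; first by rewrite !expr1.
  rewrite exprS [leRHS]exprS; apply: le_trans (cnormM _ _) _.
  exact: ler_wpM2l.
pose u n := \sum_(k < n) x ^+ k.+1.
have cnormN y : cnorm (- y : A) = cnorm y.
  by rewrite -scaleN1r cnormZ normrN1 mul1r.
(* Geometric tail estimate, multiplied by [1 - t] so that the induction telescopes. *)
have uD m d : cnorm (u (m + d)%N - u m) * (1 - t) <= t ^+ m.+1 - t ^+ (m + d).+1.
  elim: d => [|d IH]; first by rewrite addn0 !subrr cnorm0 mul0r.
  have -> : u (m + d.+1)%N - u m = (u (m + d)%N - u m) + x ^+ (m + d).+1.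
    by rewrite addnS /u big_ord_recr /= addrAC.
  apply: le_trans (_ : (cnorm (u (m + d)%N - u m) + t ^+ (m + d).+1) * (1 - t) <= _).
    apply: ler_wpM2r; first by rewrite subr_ge0 ltW.
    by apply: le_trans (cnormD _ _) _; rewrite lerD2l.
  rewrite mulrDl; apply: le_trans (lerD IH (lexx _)) _.
  by rewrite addnS [t ^+ (m + d).+2]exprS; lra.
have ucauchy e : 0 < e -> exists N, forall m n,
    (N <= m)%N -> (N <= n)%N -> cnorm (u m - u n) < e.
  move=> e0.
  have : (fun n => t ^+ n) @ \oo --> (0 : R).
    by apply: cvg_expr; rewrite ger0_norm.
  move=> /cvgrPdist_lt /(_ (e * (1 - t))).
  have e1 : 0 < e * (1 - t) by rewrite mulr_gt0 // subr_gt0.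
  move=> /(_ e1) [N _ hN]; exists N.
  have H m d : (N <= m)%N -> cnorm (u (m + d)%N - u m) < e.
    move=> Nm; rewrite -(ltr_pM2r (_ : 0 < 1 - t)) ?subr_gt0 //.
    apply: le_lt_trans (uD m d) _.
    have := hN m.+1 (leqW Nm); rewrite sub0r normrN ger0_norm ?exprn_ge0 //.
    by apply: le_lt_trans; rewrite gerBl exprn_ge0.
  move=> m n Nm Nn; case: (leqP m n) => [mn|/ltnW nm].
    by rewrite -(subnKC mn) -opprB cnormN H.
  by rewrite -(subnKC nm) H.
have [b hb] := cnorm_complete ucauchy.
have uS n : u n.+1 = x + x * u n.
  rewrite /u big_ord_recl expr1 mulr_sumr; congr (_ + _).
have bE : b = x + x * b.
  apply/eqP; rewrite -subr_eq0; apply/eqP/cnorm_eq0/eqP.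
  rewrite eq_le cnorm_ge0 andbT; apply/ler_addgt0Pr => e e0; rewrite add0r.
  have e20 : 0 < e / 2 by rewrite divr_gt0.
  have [N hN] := hb _ e20.
  (* By [u N.+1 = x + x * u N] the defect is a sum of two errors, each at most [e / 2]. *)
  have -> : b - (x + x * b) = - (u N.+1 - b) + x * (u N - b).
    by rewrite mulrBr uS opprB !opprD -!addrA addKr.
  apply: le_trans (cnormD _ _) _; rewrite cnormN [leRHS]splitr; apply: lerD.
    by apply/ltW/hN.
  apply: le_trans (cnormM _ _) _; rewrite -/t.
  apply: le_trans (_ : 1 * (e / 2) <= _); last by rewrite mul1r.
  by apply: ler_pM; rewrite ?cnorm_ge0 // ltW // hN.
have := congr1 chi bE; rewrite chiD chiM chix mul1r -[LHS]add0r => /addIr/eqP.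
by rewrite eq_sym oner_eq0.
Qed.

(** The universal property extends the counit to a character [sigma] of the full C*-algebra.
    Amenability inverts the quotient map [q], and [sigma] composed with this inverse is a character
    of C*_r(G) agreeing with the counit on C[G]. *)
Lemma amenable_counit_le (R : realType) (G : dqg R) (a : G) :
  amenable G -> coeffs G a -> complex.Re `|counit a| <= op_norm a.
Proof.
move=> [B [iota [q [[_ univ] hq qi [g qg gq]]]]] ca.
have counit_hom : @star_hom_on R G (cstarC R) (coeffs G) (@counit R G).
  split; [exact: counit1|exact: counitD|exact: counitZ|exact: counitM|].
  exact: counit_star.
have [sigma [[hs sc] _]] := univ _ _ counit_hom.
have gD x y : g (x + y) = g x + g y.
  by apply: (can_inj qg); rewrite (star_homD hq) // !gq.
have gZ c x : g (c *: x) = c *: g x.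
  by apply: (can_inj qg); rewrite (star_homZ hq) // !gq.
have gM x y : g (x * y) = g x * g y.
  by apply: (can_inj qg); rewrite (star_homM hq) // !gq.
have -> : counit a = sigma (g a) by rewrite -[a in RHS]qi // qg sc.
rewrite /op_norm -reduced.
apply: (character_le_norm (chi := fun x => sigma (g x))) => [x y|c x|x y].
- by rewrite gD (star_homD hs).
- by rewrite gZ (star_homZ hs).
- by rewrite gM (star_homM hs).
Qed.

Lemma counit_sumZ (R : realType) (G : dqg R) (I : Type) (r : seq I)
    (c : I -> R[i]) (e : I -> G) : (forall k, coeffs G (e k)) ->
  counit (\sum_(k <- r) c k *: e k) = \sum_(k <- r) c k * counit (e k).
Proof.
move=> ce; elim: r => [|k r IH].
  by rewrite !big_nil -(scale0r 0) counitZ ?mul0r //; exact: lin_span0.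
rewrite !big_cons counitD ?counitZ ?IH //; first exact: (lin_spanZ _ (ce k)).
exact: lin_span_sumZ.
Qed.

(* [f] is chosen so that its Fourier transform is the sum over [A] of [dim(alpha)]
   times the character of [alpha]. *)
Lemma rapid_decay_test (R : realType) (G : dqg R) (D : irr_data G)
    (l : Irr D -> R) (s : R) (A : {fset Irr D}) : amenable G ->
  exists2 f : CG D, in_Cc f &
    \sum_(alpha <- A) (dimI alpha)%:R ^+ 2 <= op_norm (fourier f) /\
    norm2 l s f ^+ 2 =
      \sum_(alpha <- A) ((1 + l alpha) `^ s) ^+ 2 * (dimI alpha)%:R ^+ 2.
Proof.
move=> amG.
(* In [fourierE] the inverse matrix cancels [modF alpha] and the denominator cancels [dimq alpha],
   leaving [dim(alpha)] on each diagonal coefficient. *)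
pose f : CG D := fun alpha =>
  if alpha \in A then ((dimI alpha)%:R / dimq alpha) *: invmx (modF alpha) else 0.
have fA alpha : alpha \notin A -> f alpha = 0 by rewrite /f => /negbTE ->.
have fF alpha : alpha \in A ->
    f alpha *m modF alpha = ((dimI alpha)%:R / dimq alpha)%:M.
  by rewrite /f => ->; rewrite -scalemxAl mulVmx ?modF_unit // scalemx1.
have dq0 alpha : dimq alpha != 0 :> R[i] by rewrite gt_eqF ?dimq_gt0.
have sumdiag alpha (z : R[i]) :
    \sum_(u : 'I_(cdim (@rep _ _ D alpha)) * 'I_(cdim (rep alpha)))
      z *+ (u.2 == u.1) = (dimI alpha)%:R * z.
  rewrite -(pair_bigA _ (fun i j => z *+ (j == i))) /=.
  under eq_bigr => i _ do
    rewrite (bigD1 i) //= eqxx big1 ?addr0 => [|j /negbTE ->] //.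
  by rewrite sumr_const card_ord mulr_natl.
exists f.
  apply: sub_finite_set (finite_fset A) => alpha /= fa.
  by apply: contraNT fa => /fA ->.
split.
  have cf : coeffs G (fourier f).
    rewrite (fourierE fA); apply: lin_span_sumZ => alpha.
    by apply: lin_span_sumZ => u; exact: coeffs_cmx.
  apply: le_trans (amenable_counit_le amG cf).
  rewrite (_ : counit _ = (\sum_(alpha <- A) (dimI alpha)%:R ^+ 2)%:C%C).
    by rewrite ger0_norm // ler0c sumr_ge0 // => alpha _; rewrite sqr_ge0.
  rewrite (fourierE fA) counit_sumZ => [|alpha]; last first.
    by apply: lin_span_sumZ => u; exact: coeffs_cmx.
  rewrite rmorph_sum big_seq [RHS]big_seq; apply: eq_bigr => alpha aA.
  rewrite counit_sumZ => [|u]; last exact: coeffs_cmx.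
  transitivity (dimq alpha * \sum_(u : 'I_(cdim (rep alpha)) * 'I_(cdim (rep alpha)))
      ((dimI alpha)%:R / dimq alpha) *+ (u.2 == u.1)).
    congr (_ * _); apply: eq_bigr => u _; rewrite fF // mxE counit_cmx eq_sym.
    by case: eqP => _; rewrite ?mulr1 ?mulr0.
  by rewrite sumdiag rmorphXn rmorph_nat /=; field; exact: dq0.
apply: complexI; rewrite (norm2E _ _ fA) rmorph_sum big_seq [RHS]big_seq.
apply: eq_bigr => alpha aA.
transitivity (dimq alpha ^+ 2 / (dimI alpha)%:R * (((1 + l alpha) `^ s) ^+ 2)%:C%C *
  \sum_(u : 'I_(cdim (rep alpha)) * 'I_(cdim (rep alpha)))
    ((dimI alpha)%:R / dimq alpha) ^+ 2 *+ (u.2 == u.1)).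
  congr (_ * _); apply: eq_bigr => u _; rewrite fF // mxE.
  case: eqP => _; last by rewrite normr0 expr0n.
  by rewrite !mulr1n ger0_norm // divr_ge0 // ltW // dimq_gt0.
rewrite sumdiag [RHS]rmorphM [X in _ = _ * X]rmorphXn rmorph_nat /=; field.
by rewrite dq0 pnatr_eq0 -lt0n dim_gt0.
Qed.

Lemma rapid_decay_poly_growth (R : realType) (G : dqg R) (D : irr_data G)
    (l : Irr D -> R) :
  (forall alpha, 0 <= l alpha) -> amenable G ->
  rapid_decay_wrt l -> poly_growth_wrt l.
Proof.
move=> l0 amG [c [s [c0 s0 rd]]].
(* A natural exponent above [s] turns the bound [c^2 (1 + n)^(2 s)] into a polynomial in [n]. *)
have [k sk] : exists k : nat, s <= k%:R.
  by exists (Num.bound s); apply/ltW/archi_boundP/ltW.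
exists ((c ^+ 2)%:P * (1 + 'X) ^+ (k * 2)) => n.
rewrite !hornerE.
(* The extended sum is a supremum over finite subsets of the level, so one finite [X] is bounded at
   a time. *)
apply: ge_ereal_sup => _ [X [finX XS] <-].
pose A := fset_set X.
rewrite (fsbig_finite _ _ finX) -/A sumEFin lee_fin.
set N := \sum_(alpha <- A) _.
have [f fc [Nf f2]] := rapid_decay_test l s A amG.
have N0 : 0 <= N by apply: sumr_ge0 => alpha _; rewrite sqr_ge0.
have f2N : norm2 l s f ^+ 2 <= (1 + n%:R) ^+ (k * 2) * N.
  rewrite f2 mulr_sumr big_seq [leRHS]big_seq; apply: ler_sum => alpha.
  rewrite in_fset_set // inE => /XS /= /andP[_ ln].
  rewrite ler_wpM2r ?sqr_ge0 // exprM lerXn2r ?nnegrE ?powR_ge0 ?exprn_ge0 ?addr_ge0 //.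
  rewrite -powR_mulrn ?addr_ge0 //.
  apply: (@le_trans _ _ ((1 + l alpha) `^ k%:R)).
    by rewrite ler_powR // lerDl.
  by apply: ge0_ler_powR; rewrite ?nnegrE ?addr_ge0 // lerD2l.
have NN : N ^+ 2 <= c ^+ 2 * (1 + n%:R) ^+ (k * 2) * N.
  apply: (@le_trans _ _ ((c * norm2 l s f) ^+ 2)).
    rewrite lerXn2r ?nnegrE ?mulr_ge0 ?sqrtr_ge0 ?(ltW c0) //.
    exact: le_trans Nf (rd f fc).
  by rewrite exprMn -mulrA ler_wpM2l ?sqr_ge0.
(* The bound follows on dividing by [N], which vanishes when [X] is empty. *)
have [->|Nn0] := eqVneq N 0; first by rewrite mulr_ge0 ?sqr_ge0 ?exprn_ge0 ?addr_ge0.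
by rewrite -(ler_pM2r (_ : 0 < N)) ?lt0r ?Nn0 // -expr2.
Qed.

Theorem proposition4p2 (R : realType) (G : dqg R) (D : irr_data G)
    (l : Irr D -> R) (hl : length_function l) :
  [/\ poly_growth_wrt l -> rapid_decay_wrt l,
      amenable G -> rapid_decay_wrt l -> poly_growth_wrt l
    & amenable G -> (rapid_decay D <-> poly_growth D)].
Proof.
split.
- exact: poly_growth_rapid_decay (length_ge0 hl).
- exact: rapid_decay_poly_growth (length_ge0 hl).
(* Each direction keeps the length function supplied by its hypothesis. *)
- move=> amG; split=> -[l' hl' H]; exists l' => //.
    exact: (rapid_decay_poly_growth (length_ge0 hl') amG).
  exact: poly_growth_rapid_decay (length_ge0 hl') H.
Qed.
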